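(* Let $(X,\rho_X)$ and $(Y,\rho_Y)$ be metric spaces, and suppose that $X$ is cube-decomposable. If there exists a bi-Lipschitz map $F\colon X\to Y$, then $Y$ is cube-decomposable too.
   Context: A map $F\colon X\to Y$ between metric spaces is bi-Lipschitz with constant $L$ if $F(X)=Y$ and $L^{-1}\rho_X(x_1,x_2)\le\rho_Y(F(x_1),F(x_2))\le L\rho_X(x_1,x_2)$ for all $x_1,x_2\in X$ (so bi-Lipschitz maps are surjective by definition). $B(x,R)$ denotes the open ball. A family of dyadic cubes of a metric space $(X,\rho)$ is a collection of subsets $Q_\alpha^k\subset X$, $k\in\mathbb{N}_0$, $\alpha\in I_k$ ($I_k$ index sets), for which there exist a ball constant $C>0$ and a scaling value $\delta\in(0,1)$ such that: (a) $X=\bigsqcup_{\alpha\in I_k}Q_\alpha^k$ for each $k\in\mathbb{N}_0$; (b) for each $l\ge k$, $\alpha\in I_l$, $\beta\in I_k$, either $Q_\alpha^l\subset Q_\beta^k$ or $Q_\alpha^l\cap Q_\beta^k=\emptyset$; (c) for each $Q_\alpha^k$ there is a point $x_\alpha^k\in Q_\alpha^k$ with $B(x_\alpha^k,C^{-1}\delta^k)\subseteq Q_\alpha^k\subseteq B(x_\alpha^k,C\delta^k)$. The family is connected if, in addition, (d) each $Q_\alpha^k$ is a connected subset of $X$. $X$ is cube-decomposable if it has a connected family of dyadic cubes. *)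

(* Defs.v *)
From HB Require Import structures.
From mathcomp Require Import all_boot all_order all_algebra.
From mathcomp Require Import all_classical all_reals all_analysis.

Set Implicit Arguments.
Unset Strict Implicit.
Unset Printing Implicit Defensive.

Import Order.TTheory GRing.Theory Num.Theory.

Local Open Scope classical_set_scope.
Local Open Scope ring_scope.

(* [mdist] is the distance of a metricType, [ball x r] its open ball (see
   [ballEmdist]), and [connected] refers to the topology it induces.
   A metricType may be empty. *)

Definition bi_lipschitz (R : realType) (X Y : metricType R) (L : R)
    (F : X -> Y) : Prop :=
  [/\ 0 < L, F @` [set: X] = [set: Y] &
      forall x1 x2 : X,
        L^-1 * mdist x1 x2 <= mdist (F x1) (F x2) <= L * mdist x1 x2].

(* The index sets I_k are arbitrary types. In the first clause, [trivIset]
   says that cubes with distinct indices at the same level are disjoint. *)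
Definition dyadic_cubes (R : realType) (X : metricType R) (I : nat -> Type)
    (Q : forall k : nat, I k -> set X) : Prop :=
  exists C delta : R, [/\ 0 < C, 0 < delta < 1 &
    [/\ forall k : nat,
          \bigcup_(a in [set: I k]) Q k a = [set: X] /\
          trivIset [set: I k] (Q k),
        forall (k l : nat) (a : I l) (b : I k), (k <= l)%N ->
          Q l a `<=` Q k b \/ Q l a `&` Q k b = set0
      & forall (k : nat) (a : I k), exists x : X,
          [/\ Q k a x, ball x (C^-1 * delta ^+ k) `<=` Q k a &
              Q k a `<=` ball x (C * delta ^+ k)]]].

Definition connected_dyadic_cubes (R : realType) (X : metricType R)
    (I : nat -> Type) (Q : forall k : nat, I k -> set X) : Prop :=
  dyadic_cubes Q /\ forall (k : nat) (a : I k), connected (Q k a).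

Definition cube_decomposable (R : realType) (X : metricType R) : Prop :=
  exists (I : nat -> Type) (Q : forall k : nat, I k -> set X),
    connected_dyadic_cubes Q.

(* Main.v *)
(** The images [F @` Q k a] of the cubes of [X] form a connected family of
    dyadic cubes of [Y], with the same scaling value and with ball constant
    [L * C]: bi-Lipschitz maps are continuous bijections, hence preserve
    partitions, nesting and connectedness, and they distort radii by at most
    the factor [L]. *)

Require Import Defs.
From mathcomp Require Import all_boot all_order all_algebra.
From mathcomp Require Import all_classical all_reals all_analysis.

Set Implicit Arguments.
Unset Strict Implicit.
Unset Printing Implicit Defensive.

Import Order.TTheory GRing.Theory Num.Theory.

Local Open Scope classical_set_scope.
Local Open Scope ring_scope.

Lemma image_disjoint (T U : Type) (f : T -> U) (A B : set T) :
  injective f -> A `&` B = set0 -> f @` A `&` f @` B = set0.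
Proof.
move=> f_inj AB0; rewrite -subset0 => _ [[x Ax <-] [y By /f_inj yx]].
have : (A `&` B) x by split=> //; rewrite -yx.
by rewrite AB0.
Qed.

Lemma trivIset_image_inj (T U I : Type) (D : set I) (f : T -> U)
    (A : I -> set T) :
  injective f -> trivIset D A -> trivIset D (fun i => f @` A i).
Proof.
move=> f_inj tA i j Di Dj [_ [[x Ax <-] [y Ay /f_inj yx]]].
by apply: tA => //; exists x; split=> //; rewrite -yx.
Qed.

Section BiLipschitz.
Variables (R : realType) (X Y : metricType R) (L : R) (F : X -> Y).
Hypothesis FL : bi_lipschitz L F.

(** If two points share an image, the lower Lipschitz bound leaves no room for a positive distance
    between them. *)
Lemma bi_lipschitz_inj : injective F.
Proof.
case: FL => L0 _ dF x y Fxy; apply: mdist_positivity; apply/eqP.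
have /andP[+ _] := dF x y.
rewrite Fxy mdistxx pmulr_rle0 ?invr_gt0// => d0.
by rewrite eq_le d0 mdist_ge0.
Qed.

(** The upper Lipschitz bound; it yields both continuity and the outer balls of the image cubes. *)
Lemma bi_lipschitz_image_ball (x : X) (r : R) :
  F @` ball x r `<=` ball (F x) (L * r).
Proof.
case: FL => L0 _ dF _ [y + <-]; rewrite !ballEmdist/= => xyr.
have /andP[_ /le_lt_trans->//] := dF x y.
by rewrite ltr_pM2l.
Qed.

(** Surjectivity supplies a preimage of each point of the left-hand ball, and the lower Lipschitz
    bound keeps it within [r] of [x]. This gives the inner balls of the image cubes. *)
Lemma bi_lipschitz_ball_image (x : X) (r : R) :
  ball (F x) (L^-1 * r) `<=` F @` ball x r.
Proof.
case: FL => L0 FT dF y.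
have [x' _ <-] : (F @` [set: X]) y by rewrite FT.
rewrite ballEmdist/= => Fr; exists x' => //; rewrite ballEmdist/=.
have /andP[/le_lt_trans/(_ Fr) + _] := dF x x'.
by rewrite ltr_pM2l// invr_gt0.
Qed.

Lemma bi_lipschitz_continuous : continuous F.
Proof.
have [L0 _ _] := FL.
move=> x; apply/cvg_ballP => e e0.
have r0 : 0 < L^-1 * e by rewrite mulr_gt0// invr_gt0.
(* Writing [e] as [L * (L^-1 * e)] makes [L^-1 * e] the radius to use around [x]. *)
near=> y; rewrite -(mulVKf (lt0r_neq0 L0) e).
apply: bi_lipschitz_image_ball; exists y => //.
by near: y; exact: nbhsx_ballx.
Unshelve. all: by end_near. Qed.

Lemma dyadic_cubes_image (I : nat -> Type) (Q : forall k, I k -> set X) :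
  dyadic_cubes Q -> dyadic_cubes (fun k a => F @` Q k a).
Proof.
have [L0 FT _] := FL; have Finj := bi_lipschitz_inj.
move=> [C [d [C0 d01 [Qpart Qnest Qball]]]].
exists (L * C), d; split=> //; first exact: mulr_gt0.
split=> [k|k l a b kl|k a].
- have [QT Qtriv] := Qpart k; split; last exact: trivIset_image_inj.
  (* Images commute with unions, so the covering of [Y] reduces to surjectivity, [FT]. *)
  by rewrite -image_bigcup QT.
- have [QQ|QQ] := Qnest _ _ a b kl; [left|right].
    exact: image_subset.
  exact: image_disjoint.
- have [x [Qx xQ Qx']] := Qball k a; exists (F x); split.
  + by exists x.
  (* The inner radius becomes [L^-1 * (C^-1 * d ^+ k)], that is, [L^-1] times the inner radius in
     [X]. *)
  + rewrite invfM -mulrA.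
    by apply: subset_trans _ (image_subset _ xQ); exact: bi_lipschitz_ball_image.
  + rewrite -mulrA; apply: subset_trans (image_subset _ Qx') _.
    exact: bi_lipschitz_image_ball.
Qed.

End BiLipschitz.

Theorem corollary4p4 (R : realType) (X Y : metricType R)
    (hX : cube_decomposable X)
    (hF : exists (F : X -> Y) (L : R), bi_lipschitz L F) :
  cube_decomposable Y.
Proof.
have [F [L FL]] := hF; have [I [Q [Qdyadic Qconn]]] := hX.
exists I, (fun k a => F @` Q k a); split.
  exact: dyadic_cubes_image FL _ _ Qdyadic.
move=> k a; apply: connected_continuous_connected; first exact: Qconn.
exact/continuous_subspaceT/(bi_lipschitz_continuous FL).
Qed.
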